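(* Let $R$ be an associative ring with unit and let $M$ be a retractable left $R$-module. The following conditions are equivalent: 1. $M$ is semisimple and artinian. 2. $M$ is a semiprime module and is artinian. 3. $M$ is a semiprime module and satisfies the descending chain condition on cyclic submodules and the descending chain condition on direct summands.
   Context: Modules are unitary left $R$-modules. $M$ is retractable if $Hom_R(M,N)\neq 0$ for all $0\neq N\leq M$. For submodules $K,L\leq M$, $K_ML=\sum\{f(K)\mid f\in Hom_R(M,L)\}$. A submodule $K\le M$ is fully invariant if $f(K)\le K$ for all $f\in End_R(M)$. $M$ is a semiprime module if for every fully invariant submodule $K\leq M$, $K_MK=0$ implies $K=0$. Artinian (the paper says ''left artinian'') means the descending chain condition on submodules of the left module $M$. *)

(* Defs.v *)
From HB Require Import structures.
From mathcomp Require Import all_boot all_order all_algebra.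
From mathcomp Require Import boolp classical_sets.

Set Implicit Arguments.
Unset Strict Implicit.
Unset Printing Implicit Defensive.

Import GRing.Theory.

Local Open Scope classical_set_scope.
Local Open Scope ring_scope.

(* [lmodType R] is the type of unitary left modules over the possibly trivial
   ring [R]. Submodules are represented by their underlying sets. *)
Section Submodules.
Context {R : pzRingType} {M : lmodType R}.
Implicit Types (F : set (set M)) (K L N : set M).

Definition submodule N : Prop := GRing.submod_closed (mem N).

(* The sum of a family of submodules: all finite sums of elements, each taken
   from some member of [F]; the empty family has sum {0}. *)
Definition sum_submod F : set M :=
  [set x | exists2 s : seq M,
     {in s, forall y, (\bigcup_(N in F) N) y} & x = \sum_(y <- s) y].

(* Hom_R(M, L), each map being identified with its composite with the
   inclusion of [L] into [M]. *)
Definition hom_into L : set {linear M -> M} :=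
  [set f : {linear M -> M} | forall x, L (f x)].

(* K_M L *)
Definition submod_prod K L : set M :=
  sum_submod [set f @` K | f in hom_into L].

Definition fully_invariant K : Prop :=
  forall f : {linear M -> M}, f @` K `<=` K.

Definition simple_submodule N : Prop :=
  [/\ submodule N, N <> [set 0] &
      forall K, submodule K -> K `<=` N -> K = [set 0] \/ K = N].

Definition independent F : Prop :=
  forall N, F N -> N `&` sum_submod (F `\ N) = [set 0].

Definition cyclic_submodule N : Prop :=
  exists x : M, N = range (fun a : R => a *: x).

Definition direct_summand N : Prop :=
  submodule N /\
  exists L, [/\ submodule L, N `&` L = [set 0]
              & [set x + y | x in N & y in L] = setT].

Definition dcc_on (P : set (set M)) : Prop :=
  forall N : nat -> set M,
    (forall n, P (N n)) -> (forall n, N n.+1 `<=` N n) ->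
    exists m, forall n, (m <= n)%N -> N n = N m.

End Submodules.

Section Modules.
Context {R : pzRingType} (M : lmodType R).

Definition retractable : Prop :=
  forall N : set M, submodule N -> N <> [set 0] ->
    exists2 f : {linear M -> M}, hom_into N f & exists x, f x <> 0.

Definition semiprime : Prop :=
  forall K : set M, submodule K -> fully_invariant K ->
    submod_prod K K = [set 0] -> K = [set 0].

(* [M] is a direct sum of simple submodules. Independence makes the summands
   pairwise distinct, so indexing them by themselves loses no generality. *)
Definition semisimple : Prop :=
  exists F : set (set M),
    [/\ forall N, F N -> simple_submodule N, independent F
      & sum_submod F = setT].

Definition artinian : Prop := dcc_on (@submodule R M).

Definition dcc_cyclic_submodules : Prop := dcc_on (@cyclic_submodule R M).

Definition dcc_direct_summands : Prop := dcc_on (@direct_summand R M).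

End Modules.

(* Main.v *)
(* The crux is that a simple submodule S of a semiprime module M splits off.
   Otherwise every map M -> S kills S, and one considers the fully invariant
   submodule K = sum of all g(S), g in End(M).  If h : M -> K and h(g(s)) = y
   were nonzero, a submodule U maximal among those avoiding y would satisfy
   K <= U (+) g'(S) for some g', and projecting K to g'(S) ~ S would give a map
   M -> S which does not kill s.  Hence K_M K = 0, so K = 0 and S = 0.
   With the chain conditions every nonzero submodule contains a simple one, and
   a direct summand minimal for a suitable property must vanish, since otherwise
   a simple submodule could be split off from it; this yields both a
   decomposition of M into simples and a complement for every submodule.
   Conversely, if M is a direct sum of simples and x <> 0 lies in a fully
   invariant K, some projection p onto a simple summand S has p x <> 0; then
   p x lies in K, so S <= K and p x lies in K_M K. *)
Require Import Defs.
From mathcomp Require Import all_boot all_order all_algebra.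
From HB Require Import structures.
From mathcomp Require Import boolp classical_sets.

Set Implicit Arguments.
Unset Strict Implicit.
Unset Printing Implicit Defensive.

Import GRing.Theory.

Local Open Scope classical_set_scope.
Local Open Scope ring_scope.

Section SubmoduleTheory.
Context {R : pzRingType} {M : lmodType R}.
Implicit Types (F : set (set M)) (K L N S U V : set M) (f g h : {linear M -> M}).

(** * Closure properties of submodules *)

Lemma submoduleP N :
  submodule N <-> N 0 /\ forall a x y, N x -> N y -> N (a *: x + y).
Proof.
split=> [[N0 NL]|[N0 NL]].
  split=> [|a x y Nx Ny]; first by move: N0; rewrite inE.
  by have := NL a x y; rewrite !inE; apply.
split=> [|a x y]; first by rewrite inE.
by rewrite !inE; exact: NL.
Qed.

Lemma submod0 N : submodule N -> N 0.
Proof. by move/submoduleP=> []. Qed.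

Lemma submodZD N a x y : submodule N -> N x -> N y -> N (a *: x + y).
Proof. by move/submoduleP=> [_]; apply. Qed.

Lemma submodD N x y : submodule N -> N x -> N y -> N (x + y).
Proof. by move=> sN Nx Ny; rewrite -[x]scale1r; exact: submodZD. Qed.

Lemma submodZ N a x : submodule N -> N x -> N (a *: x).
Proof.
by move=> sN Nx; rewrite -[a *: x]addr0; apply: submodZD => //; exact: submod0.
Qed.

Lemma submodB N x y : submodule N -> N x -> N y -> N (x - y).
Proof. by move=> sN Nx Ny; rewrite addrC -scaleN1r; exact: submodZD. Qed.

Lemma submod_sum N (s : seq M) :
  submodule N -> (forall y, y \in s -> N y) -> N (\sum_(y <- s) y).
Proof.
move=> sN Ns; rewrite big_seq; elim/big_ind: _ => //; first exact: submod0.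
by move=> x y; exact: submodD.
Qed.

Lemma submodule0 : submodule [set (0 : M)].
Proof. by apply/submoduleP; split=> // a x y /= -> ->; rewrite scaler0 addr0. Qed.

Lemma submoduleT : submodule [set: M].
Proof. by apply/submoduleP. Qed.

Lemma submoduleI N L : submodule N -> submodule L -> submodule (N `&` L).
Proof.
move=> sN sL; apply/submoduleP; split=> [|a x y [Nx Lx] [Ny Ly]].
  by split; exact: submod0.
by split; exact: submodZD.
Qed.

Lemma submodule_preimage f N : submodule N -> submodule (f @^-1` N).
Proof.
move=> sN; apply/submoduleP; split=> [|a x y /= Nx Ny] /=.
  by rewrite linear0; exact: submod0.
by rewrite linearP; exact: submodZD.
Qed.

Lemma submodule_image f N : submodule N -> submodule (f @` N).
Proof.
move=> sN; apply/submoduleP; split.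
  by exists 0; [exact: submod0|rewrite linear0].
move=> a _ _ [x Nx <-] [y Ny <-].
by exists (a *: x + y); [exact: submodZD|rewrite linearP].
Qed.

Lemma submodule_add N L :
  submodule N -> submodule L -> submodule [set x + y | x in N & y in L].
Proof.
move=> sN sL; apply/submoduleP; split.
  by exists 0; [exact: submod0|exists 0; [exact: submod0|rewrite addr0]].
move=> a _ _ [x Nx [y Ly <-]] [x' Nx' [y' Ly' <-]].
exists (a *: x + x'); first exact: submodZD.
by exists (a *: y + y'); [exact: submodZD|rewrite scalerDr addrACA].
Qed.

Lemma submodule_cyclic (x : M) : submodule (range (fun a : R => a *: x)).
Proof.
apply/submoduleP; split; first by exists 0 => //; rewrite scale0r.
move=> a _ _ [b _ <-] [c _ <-].
by exists (a * b + c) => //; rewrite scalerDl scalerA.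
Qed.

Lemma submodule_neq0 N : submodule N -> N <> [set 0] -> exists2 x, N x & x <> 0.
Proof.
move=> sN N0; apply: contrapT => nex; apply: N0.
apply/seteqP; split=> [x Nx /=|_ ->]; last exact: submod0.
by apply: contrapT => x0; apply: nex; exists x.
Qed.

(** * Sums of families, and simple submodules *)

Lemma sum_submod_sup F N : F N -> N `<=` sum_submod F.
Proof.
move=> FN x Nx; exists [:: x]; last by rewrite big_seq1.
by move=> y; rewrite inE => /eqP ->; exists N.
Qed.

Lemma sum_submod_least F V : submodule V ->
  (forall N, F N -> N `<=` V) -> sum_submod F `<=` V.
Proof.
move=> sV FV x [s Fs ->]; apply: submod_sum => // y /Fs [N FN Ny].
exact: (FV N).
Qed.

Lemma sum_submod0 F : sum_submod F 0.
Proof. by exists [::]; rewrite ?big_nil. Qed.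

Lemma submodule_sum_submod F :
  (forall N, F N -> submodule N) -> submodule (sum_submod F).
Proof.
move=> sF; apply/submoduleP; split; first exact: sum_submod0.
move=> a _ _ [s Fs ->] [t Ft ->].
exists ([seq a *: y | y <- s] ++ t); last by rewrite big_cat big_map scaler_sumr.
move=> y; rewrite mem_cat => /orP[/mapP[z /Fs [N FN Nz] ->]|/Ft //].
by exists N => //; apply: submodZ => //; exact: sF.
Qed.

Lemma sum_submodS F (G : set (set M)) : F `<=` G -> sum_submod F `<=` sum_submod G.
Proof. by move=> FG x [s Fs ->]; exists s => // y /Fs[N /FG GN Ny]; exists N. Qed.

(** The intersection of [S] and [V] is nonzero, hence all of [S]. With [V] a kernel, a preimage or
    an image, this plays the role of Schur's lemma. *)
Lemma simple_sub S V x :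
  simple_submodule S -> submodule V -> S x -> V x -> x <> 0 -> S `<=` V.
Proof.
move=> [sS _ Smin] sV Sx Vx x0.
have [] // := Smin (S `&` V) (submoduleI sS sV) (@subIsetl _ S V).
  by move=> SV0; case: x0; have : (S `&` V) x by []; rewrite SV0.
by move=> <-; exact: subIsetr.
Qed.

(** * Linear maps obtained from their graphs *)

Lemma linear_of_rel (P : M -> M -> Prop) :
  (forall x, exists y, P x y) -> (forall x y z, P x y -> P x z -> y = z) ->
  (forall a x x' y y', P x y -> P x' y' -> P (a *: x + x') (a *: y + y')) ->
  exists f, forall x, P x (f x).
Proof.
move=> /choice[f Pf] Puniq Plin.
have flin : linear f.
  by move=> a x y; apply: (Puniq (a *: x + y)) => //; exact: Plin.
pose fM := GRing.isLinear.Build R M M _ f flin.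
pose fL : {linear M -> M} := HB.pack f fM.
by exists fL.
Qed.

Lemma direct_sum_proj N L : submodule N -> submodule L -> N `&` L = [set 0] ->
  [set x + y | x in N & y in L] = setT ->
  exists p : {linear M -> M}, [/\ hom_into N p, forall x, N x -> p x = x
    & forall x, L x -> p x = 0].
Proof.
move=> sN sL NL0 NLT.
(* That is, [y] is the [N]-component of [x]. *)
pose P x y := N y /\ L (x - y).
have Puniq x y z : P x y -> P x z -> y = z.
  move=> [Ny Lxy] [Nz Lxz]; apply/eqP; rewrite -subr_eq0; apply/eqP.
  suff : (N `&` L) (y - z) by rewrite NL0.
  split; first exact: submodB.
  have -> : y - z = (x - z) - (x - y) by rewrite opprB [RHS]addrC subrKA.
  exact: submodB.
have [||p Pp] := @linear_of_rel P _ Puniq.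
- move=> x; have : [set x + y | x in N & y in L] x by rewrite NLT.
  by move=> [y Ny [z Lz <-]]; exists y; split; rewrite // addrC addKr.
- move=> a x x' y y' [Ny Lxy] [Ny' Lxy']; split; first exact: submodZD.
  by rewrite opprD addrACA -scalerBr; exact: submodZD.
exists p; split=> x; first by have [] := Pp x.
- by move=> Nx; apply: (Puniq x) => //; split; rewrite // subrr; exact: submod0.
- by move=> Lx; apply: (Puniq x) => //; split; rewrite ?subr0 //; exact: submod0.
Qed.

(** * Splitting off a simple submodule *)

Lemma maximal_avoiding (y : M) : y <> 0 -> exists U,
  [/\ submodule U, ~ U y & forall V, submodule V -> U `<=` V -> ~ V y -> V `<=` U].
Proof.
move=> y0.
(* Nonemptiness is left out so that the union of the empty chain qualifies. *)
pose P (A : set M) := (forall a x z, A x -> A z -> A (a *: x + z)) /\ ~ A y.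
have [F FP Ftot|U [[UL Uy] Umax]] := @Zorn_bigcup M P.
  split=> [a x z [A FA Ax] [B FB Bz]|[A /FP[_ nAy]] //].
  have [AB|BA] := Ftot A B FA FB.
    by exists B => //; have [BL _] := FP B FB; apply: BL => //; exact: AB.
  by exists A => //; have [AL _] := FP A FA; apply: AL => //; exact: BA.
have Umax' V : submodule V -> U `<=` V -> ~ V y -> V `<=` U.
  move=> sV UV Vy; apply: contrapT => nVU.
  by apply: (Umax V) => //; split=> // a x z; exact: submodZD.
exists U; split=> //; apply/submoduleP; split=> //.
(* An empty [U] would, by maximality, have to contain the zero submodule, which avoids [y] because
   [y] is nonzero. *)
have [U0|/set0P[x Ux]] := eqVneq U set0; last first.
  by have := UL (-1) x x Ux Ux; rewrite scaleN1r addNr.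
by apply: (Umax' [set 0] submodule0) => //; rewrite U0.
Qed.

(** Every submodule strictly above [U] contains [y], so M/U has a smallest nonzero submodule. The
    image in M/U of any g(S) not inside [U] is simple, hence equal to that smallest one; thus all
    such images coincide. *)
Lemma simple_image_sub_add S U y f g :
  simple_submodule S -> submodule U -> ~ U y ->
  (forall V, submodule V -> U `<=` V -> ~ V y -> V `<=` U) ->
  ~ (g @` S `<=` U) -> f @` S `<=` [set u + v | u in U & v in g @` S].
Proof.
move=> Ssimple sU nUy Umax; have [sS _ _] := Ssimple.
have add_y (g' : {linear M -> M}) : ~ (g' @` S `<=` U) ->
    [set u + v | u in U & v in g' @` S] y.
  move=> ngU; apply: contrapT => nWy; apply: ngU => v gSv.
  apply: (Umax _ _ _ nWy).
  - by apply: submodule_add => //; exact: submodule_image.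
  - move=> u Uu; exists u => //; exists 0; last by rewrite addr0.
    exact: submod0 (submodule_image g' sS).
  - by exists 0; [exact: submod0|exists v; rewrite ?add0r].
move=> ngU; set W := [set u + v | u in U & v in _].
have sW : submodule W by apply: submodule_add => //; exact: submodule_image.
have UW : U `<=` W.
  move=> u Uu; exists u => //; exists 0; last by rewrite addr0.
  exact: submod0 (submodule_image g sS).
have [fU|nfU] := pselect (f @` S `<=` U); first exact: subset_trans UW.
have [u Uu [_ [t St <-] uty]] := add_y _ nfU.
have Wft : W (f t).
  have -> : f t = y - u by rewrite -uty addrC addKr.
  by apply: submodB => //; [exact: add_y|exact: UW].
have t0 : t <> 0 by move=> t0; apply: nUy; rewrite -uty t0 linear0 addr0.
have SW := simple_sub Ssimple (submodule_preimage f sW) St Wft t0.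
by move=> _ [x /SW Wx <-].
Qed.

Lemma simple_hom_neq0 S : semiprime M -> simple_submodule S ->
  exists2 f : {linear M -> M}, hom_into S f & exists2 x, S x & f x <> 0.
Proof.
move=> Mprime Ssimple; have [sS S0 _] := Ssimple.
apply: contrapT => noS.
have homS0 f x : hom_into S f -> S x -> f x = 0.
  move=> fS Sx; apply: contrapT => fx0; apply: noS.
  by exists f => //; exists x.
pose F := range (fun g : {linear M -> M} => g @` S).
pose K := sum_submod F.
have sK : submodule K.
  by apply: submodule_sum_submod => _ [g _ <-]; exact: submodule_image.
have KgS g s : S s -> K (g s).
  by move=> Ss; apply: (@sum_submod_sup F (g @` S)); [exists g|exists s].
suff K0 : K = [set 0].
  apply: S0; apply/seteqP; split=> [x Sx|_ ->]; last exact: submod0.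
  by rewrite -K0; exact: (KgS idfun).
apply: Mprime => //.
  move=> f _ [x Kx <-]; suff : K `<=` f @^-1` K by apply.
  apply: sum_submod_least; first exact: submodule_preimage.
  by move=> _ [g _ <-] _ [s Ss <-]; exact: (KgS (f \o g)).
apply/seteqP; split=> [|_ ->]; last exact: sum_submod0.
apply: sum_submod_least; first exact: submodule0.
move=> _ [h hK <-] _ [x Kx <-].
suff : K `<=` h @^-1` [set 0] by apply.
apply: sum_submod_least; first exact: submodule_preimage submodule0.
move=> _ [g1 _ <-] _ [s Ss <-] /=; apply: contrapT => y0.
have [U [sU nUy Umax]] := maximal_avoiding y0.
(* If [U] contained every g(S), it would contain [K], hence also [y], which is a value of [h]. *)
have [g ngU] : exists g, ~ (g @` S `<=` U).
  apply: contrapT => gU; apply: nUy.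
  suff : K `<=` U by apply; exact: hK.
  apply: sum_submod_least => // _ [g _ <-].
  by apply: contrapT => ngU; apply: gU; exists g.
have KW : K `<=` [set u + v | u in U & v in g @` S].
  apply: sum_submod_least.
    by apply: submodule_add => //; exact: submodule_image.
  by move=> _ [f _ <-]; exact: (simple_image_sub_add Ssimple sU nUy Umax).
(* So [g] is injective on [S] and the sum of [U] and g(S) is direct; this makes the relation [P]
   below functional. *)
have gU0 t : S t -> U (g t) -> t = 0.
  move=> St Ut; apply: contrapT => t0; apply: ngU.
  have SU := simple_sub Ssimple (submodule_preimage g sU) St Ut t0.
  by move=> _ [z /SU Uz <-].
(* [P] is the composite of [h \o g1], the projection of [U (+) g(S)] onto
   [g(S)], and the inverse of [g : S -> g(S)]. *)
pose P x t := S t /\ U (h (g1 x) - g t).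
have [|z t t' [St Ut] [St' Ut']|a z z' t t' [St Ut] [St' Ut']|p Pp] :=
    @linear_of_rel P.
- move=> z; have [u Uu [_ [t St <-] utE]] := KW _ (hK (g1 z)).
  by exists t; split=> //; rewrite -utE addrK.
- apply/eqP; rewrite -subr_eq0; apply/eqP; apply: gU0; first exact: submodB.
  have -> : g (t - t') = (h (g1 z) - g t') - (h (g1 z) - g t).
    by rewrite linearB opprB [RHS]addrC subrKA.
  exact: submodB.
- split; first exact: submodZD.
  by rewrite !linearP addrACA -scalerDr; exact: submodZD.
have pS : hom_into S p by move=> z; have [] := Pp z.
(* Being a map into [S], [p] kills [s], so [Pp s] puts [y] itself in [U]. *)
have [_] := Pp s; rewrite (homS0 p s pS Ss) linear0 subr0.
exact: nUy.
Qed.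

Lemma direct_summandT : direct_summand [set: M].
Proof.
split; first exact: submoduleT.
exists [set 0]; split; [exact: submodule0|by rewrite setTI|].
by apply/seteqP; split=> // x _; exists x => //; exists 0; rewrite ?addr0.
Qed.

(** A map [f] into [S] that is nonzero on [S] restricts to an automorphism of [S], so M is the
    direct sum of [S] and ker f. By the modular law [L] splits likewise, with [L'] its intersection
    with ker f. *)
Lemma direct_summand_split S L : semiprime M ->
  simple_submodule S -> direct_summand L -> S `<=` L ->
  exists L', [/\ direct_summand L', L' `<=` L, S `&` L' = [set 0]
    & L = [set x + y | x in S & y in L']].
Proof.
move=> Mprime Ssimple [sL [C [sC LC0 LCT]]] SL; have [sS _ _] := Ssimple.
have [f fS [s0 Ss0 fs0]] := simple_hom_neq0 Mprime Ssimple.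
have skerf : submodule (f @^-1` [set 0]) by exact: submodule_preimage submodule0.
have kerfS x : S x -> f x = 0 -> x = 0.
  move=> Sx fx0; apply: contrapT => x0; apply: fs0.
  exact: (simple_sub Ssimple skerf Sx fx0 x0).
have imfS : S `<=` f @` S.
  by apply: (simple_sub Ssimple (submodule_image f sS) (fS s0)).
pose L' := L `&` f @^-1` [set 0].
have sL' : submodule L' by exact: submoduleI.
have LE : L = [set x + y | x in S & y in L'].
  apply/seteqP; split=> [x Lx|_ [x Sx [y [Ly _] <-]]]; last first.
    by apply: submodD => //; exact: SL.
  have [s Ss fsx] := imfS _ (fS x).
  exists s => //; exists (x - s); last by rewrite addrC subrK.
  split; first by apply: submodB => //; exact: SL.
  by rewrite /= linearB fsx subrr.
have SL'0 : S `&` L' = [set 0].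
  apply/seteqP; split=> [x [Sx [_ fx0]]|_ ->]; first exact: kerfS.
  by split; exact: submod0.
exists L'; split=> //; last exact: subIsetl.
(* From M = L + C and L = S + L', both direct, S + C is a complement of [L']. *)
split=> //; exists [set x + y | x in S & y in C]; split; first exact: submodule_add.
- apply/seteqP; split=> [x [[Lx fx0] [s Ss [c Cc scE]]]|_ ->].
    have c0 : c = 0.
      suff : (L `&` C) c by rewrite LC0.
      split=> //; have -> : c = s + c - s by rewrite addrC addKr.
      by rewrite scE; apply: submodB => //; exact: SL.
    by apply: kerfS => //; rewrite -scE c0 addr0.
  by split; apply: submod0 => //; exact: submodule_add.
- apply/seteqP; split=> // x _; have : [set x + y | x in L & y in C] x by rewrite LCT.
  move=> [l]; rewrite {1}LE => -[s Ss [l' Ll' <-]] [c Cc <-].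
  exists l' => //; exists (s + c); last by rewrite addrA [l' + s]addrC.
  by exists s => //; exists c.
Qed.

(** * Consequences of the chain conditions *)

Lemma dcc_on_minimal (P Q : set (set M)) : dcc_on P ->
  (exists2 N, P N & Q N) ->
  exists N, [/\ P N, Q N & forall K, P K -> Q K -> K `<=` N -> K = N].
Proof.
move=> Pdcc [N0 PN0 QN0]; apply: contrapT => nomin.
(* Without a minimal element, [next] picks a strictly smaller one each time, and its iterates from
   [N0] never stabilise. *)
have /choice[next nextP] N : exists K, P N -> Q N ->
    [/\ P K, Q K, K `<=` N & K <> N].
  have [[PN QN]|nPQ] := pselect (P N /\ Q N); last first.
    by exists N => PN QN; case: nPQ.
  apply: contrapT => noK; apply: nomin; exists N; split=> // K PK QK KN.
  by apply: contrapT => neqKN; apply: noK; exists K.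
have PQ n : P (iter n next N0) /\ Q (iter n next N0).
  by elim: n => //= n [PN QN]; have [] := nextP _ PN QN.
have [n|m /(_ m.+1 (leqnSn m))] := Pdcc (fun n => iter n next N0) (fun n => (PQ n).1).
  by have [PN QN] := PQ n; have [] := nextP _ PN QN.
by have [PN QN] := PQ m; have [] := nextP _ PN QN.
Qed.

(** A minimal nonzero cyclic submodule [C] of [N] is simple: a nonzero [K] inside [C] contains a
    nonzero cyclic submodule, which is [C] by minimality. *)
Lemma simple_in_submodule N : dcc_cyclic_submodules M ->
  submodule N -> N <> [set 0] -> exists2 S, simple_submodule S & S `<=` N.
Proof.
move=> Mdcc sN N0.
have sub_cyclic K x : submodule K -> K x -> range (fun a : R => a *: x) `<=` K.
  by move=> sK Kx _ [a _ <-]; exact: submodZ.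
have cyclic_neq0 (x : M) : x <> 0 -> range (fun a : R => a *: x) <> [set 0].
  move=> x0 Rx0; apply: x0; have : range (fun a : R => a *: x) x.
    by exists 1; rewrite ?scale1r.
  by rewrite Rx0.
have [x Nx x0] := submodule_neq0 sN N0.
have [|C [cC [C0 CN] Cmin]] :=
    @dcc_on_minimal _ [set C | C <> [set 0] /\ C `<=` N] Mdcc.
  exists (range (fun a : R => a *: x)); first by exists x.
  by split; [exact: cyclic_neq0|exact: sub_cyclic].
exists C => //; split=> //; first by have [z ->] := cC; exact: submodule_cyclic.
move=> K sK KC; have [->|nK0] := pselect (K = [set 0]); first by left.
right; have [y Ky y0] := submodule_neq0 sK nK0.
apply/seteqP; split=> //.
rewrite -(Cmin (range (fun a : R => a *: y))).
- exact: sub_cyclic.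
- by exists y.
- split; first exact: cyclic_neq0.
  by apply: sub_cyclic => //; exact/CN/KC.
- by apply: subset_trans KC; exact: sub_cyclic.
Qed.

Lemma simple_split_proper S L L' : simple_submodule S -> S `<=` L ->
  S `&` L' = [set 0] -> L' <> L.
Proof.
move=> [sS S0 _] SL SL'0 L'L; apply: S0.
by rewrite -SL'0 L'L; apply/seteqP; split=> x; [move=> Sx; split=> //; exact: SL|case].
Qed.

(** Take a direct summand [L] minimal with N + L = M. A simple submodule inside both [N] and [L]
    could be split off from [L] and absorbed by [N], leaving a smaller such summand; so [N] and [L]
    meet in 0. *)
Lemma submodule_direct_summand N : semiprime M ->
  dcc_cyclic_submodules M -> dcc_direct_summands M ->
  submodule N -> direct_summand N.
Proof.
move=> Mprime Mcyc Msum sN.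
have [|L [dL NLT Lmin]] := @dcc_on_minimal _
    [set L | [set x + y | x in N & y in L] = setT] Msum.
  exists setT; first exact: direct_summandT.
  apply/seteqP; split=> // x _.
  by exists 0; [exact: submod0|exists x; rewrite ?add0r].
have sL := dL.1; split=> //; exists L; split=> //.
apply: contrapT => NL0.
have [S Ssimple SNL] := simple_in_submodule Mcyc (submoduleI sN sL) NL0.
have SL : S `<=` L by move=> x /SNL[].
have [L' [dL' L'L SL'0 LE]] := direct_summand_split Mprime Ssimple dL SL.
apply: (simple_split_proper Ssimple SL SL'0); apply: Lmin => //=.
apply/seteqP; split=> // x _.
have : [set x + y | x in N & y in L] x by rewrite NLT.
move=> [n Nn [l]]; rewrite LE => -[s Ss [l' Ll' <-]] <-.
exists (n + s); last by exists l'; rewrite ?addrA.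
by apply: submodD => //; have [] := SNL _ Ss.
Qed.

(** * Decomposition into simple submodules *)

Lemma sum_submodU1 S F : submodule S ->
  sum_submod (S |` F) `<=` [set x + y | x in S & y in sum_submod F].
Proof.
move=> sS x [s]; elim: s x => [|z s IHs] x.
  move=> _ ->; rewrite big_nil; exists 0; first exact: submod0.
  by exists 0; [exact: sum_submod0|rewrite addr0].
move=> Fs ->; rewrite big_cons.
have [|a Sa [b [t Ft bE] <-]] := IHs (\sum_(y <- s) y) _ erefl.
  by move=> y ys; apply: Fs; rewrite inE ys orbT.
have [N [->|FN] Nz] := Fs z (mem_head _ _).
  exists (z + a); first exact: submodD.
  by exists b; [exists t|rewrite addrA].
exists a => //; exists (z + b); last by rewrite addrCA.
exists (z :: t); last by rewrite big_cons bE.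
by move=> y; rewrite inE => /predU1P[->|/Ft//]; exists N.
Qed.

(** If [x] in a member [N] of [F] equals s + t, with [s] in [S] and [t] in the sum of the other
    members of [F], then s = x - t lies in the sum of [F]. So s = 0, and independence of [F] gives x
    = 0. *)
Lemma independentU1 S F : submodule S -> (forall N, F N -> submodule N) ->
  S `&` sum_submod F = [set 0] -> independent F -> independent (S |` F).
Proof.
move=> sS sF SF0 indF N SFN.
have [SN|NS] := pselect (S = N).
  subst N.
  apply/seteqP; split=> [x [Sx Fx]|_ ->]; last first.
    by split; [exact: submod0|exact: sum_submod0].
  rewrite -SF0; split=> //; apply: sum_submodS Fx.
  by move=> K [[->|//] nKS]; case: nKS.
have FN : F N by case: SFN => // /esym.
apply/seteqP; split=> [x [Nx Fx]|_ ->]; last first.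
  by split; [exact: submod0 (sF _ FN)|exact: sum_submod0].
have sFN : submodule (sum_submod F) by exact: submodule_sum_submod.
have FNF : sum_submod (F `\ N) `<=` sum_submod F by apply: sum_submodS => K [].
have [|s Ss [t Ft stx]] := @sum_submodU1 S (F `\ N) sS x.
  apply: sum_submodS Fx => K [[KS|FK] nKN]; first by left.
  by right.
have s0 : s = 0.
  suff : (S `&` sum_submod F) s by rewrite SF0.
  split=> //; have -> : s = x - t by rewrite -stx addrK.
  by apply: submodB => //; [exact: (sum_submod_sup FN)|exact: FNF].
rewrite -(indF N FN); split=> //.
by rewrite -stx s0 add0r.
Qed.

Lemma semiprime_dcc_semisimple : semiprime M ->
  dcc_cyclic_submodules M -> dcc_direct_summands M -> semisimple M.
Proof.
move=> Mprime Mcyc Msum.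
(* Here [L] is what remains of M once a direct sum of simples is removed. A minimal remainder is
   zero, since a simple submodule of it could be moved into [F]. *)
pose Q L := exists F, [/\ forall N, F N -> simple_submodule N, independent F,
  sum_submod F `&` L = [set 0] & [set x + y | x in sum_submod F & y in L] = setT].
have [|L [dL [F [Fsimple indF FL0 FLT]] Lmin]] := @dcc_on_minimal _ Q Msum.
  exists setT; first exact: direct_summandT.
  exists set0; split=> //.
    rewrite setIT; apply/seteqP; split=> [|_ ->]; last exact: sum_submod0.
    exact: sum_submod_least submodule0 _.
  apply/seteqP; split=> // x _.
  by exists 0; [exact: sum_submod0|exists x; rewrite ?add0r].
have sF N : F N -> submodule N by move=> /Fsimple[].
have sL := dL.1; have sFs := submodule_sum_submod sF.
have [L0|nL0] := pselect (L = [set 0]).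
  exists F; split=> //; rewrite -FLT L0; apply/seteqP; split=> [x Fx|].
    by exists x => //; exists 0; rewrite ?addr0.
  by move=> _ [x Fx [_ -> <-]]; rewrite addr0.
have [S Ssimple SL] := simple_in_submodule Mcyc sL nL0.
have [sS _ _] := Ssimple.
have [L' [dL' L'L SL'0 LE]] := direct_summand_split Mprime Ssimple dL SL.
case: (simple_split_proper Ssimple SL SL'0); apply: Lmin => //.
have sL' := dL'.1.
exists (S |` F); split.
- by move=> N [->|/Fsimple].
- apply: independentU1 => //; apply/seteqP; split=> [x [Sx Fx]|_ ->].
    by rewrite -FL0; split=> //; exact: SL.
  by split; exact: submod0.
- apply/seteqP; split=> [x [/(sum_submodU1 sS)[s Ss [t Ft <-]] L'st]|_ ->]; last first.
    by split; [exact: sum_submod0|exact: submod0].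
  have t0 : t = 0.
    suff : (sum_submod F `&` L) t by rewrite FL0.
    split=> //; have -> : t = s + t - s by rewrite addrC addKr.
    by apply: submodB => //; [exact: L'L|exact: SL].
  by move: L'st; rewrite t0 addr0 -SL'0.
- apply/seteqP; split=> // x _.
  have : [set x + y | x in sum_submod F & y in L] x by rewrite FLT.
  move=> [t Ft [l]]; rewrite LE => -[s Ss [l' Ll' <-]] <-.
  exists (t + s); last by exists l'; rewrite ?addrA.
  have sSF : submodule (sum_submod (S |` F)).
    by apply: submodule_sum_submod => N [->|/sF].
  apply: submodD => //; last by apply: (@sum_submod_sup _ S) => //; left.
  by apply: sum_submodS Ft => N; right.
Qed.

(** * Projections onto summands, and semiprimeness *)

Definition summand_proj F N (p : {linear M -> M}) : Prop :=
  [/\ hom_into N p, forall x, N x -> p x = x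
    & forall K x, F K -> K <> N -> K x -> p x = 0].

Lemma summand_proj_exists F N : (forall K, F K -> submodule K) ->
  independent F -> sum_submod F = setT -> F N -> exists p, summand_proj F N p.
Proof.
move=> sF indF FT FN.
have sFN : submodule (sum_submod (F `\ N)).
  by apply: submodule_sum_submod => K [/sF].
have [|p [pN idp p0]] := direct_sum_proj (sF N FN) sFN (indF N FN).
  apply/seteqP; split=> // x _; apply: sum_submodU1; first exact: sF.
  suff : sum_submod F x.
    by apply: sum_submodS => K FK; have [->|] := pselect (K = N); [left|right].
  by rewrite FT.
by exists p; split=> // K x FK KN Kx; apply: p0; exact: (@sum_submod_sup _ K).
Qed.

(** Induction on the length of a list of terms with sum [x]. It is strong induction because the
    first term is deleted together with all others in the same summand. *)
Lemma summand_proj_eq0 F x : (forall K, F K -> submodule K) ->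
  independent F -> sum_submod F = setT ->
  (forall N p, F N -> summand_proj F N p -> p x = 0) -> x = 0.
Proof.
move=> sF indF FT px0; have : sum_submod F x by rewrite FT.
move=> [s Fs xE]; have [n] := ubnP (size s).
elim: n s Fs xE => // n IHn [|y s] Fs xE; first by rewrite xE big_nil.
rewrite ltnS => lesn.
have [N FN Ny] := Fs y (mem_head _ _).
have Fs' z : z \in s -> exists2 K, F K & K z.
  by move=> zs; apply: (Fs z); rewrite inE zs orbT.
have [p pP] := summand_proj_exists sF indF FT FN.
have [_ idp p0] := pP.
(* The terms lying in [N] add up to [p x = 0], so they may be dropped. *)
apply: (IHn [seq z <- s | ~~ `[< N z >]]).
- by move=> z; rewrite mem_filter => /andP[_ /Fs'].
- have -> : x = x - p x by rewrite (px0 N p FN pP) subr0.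
  rewrite xE big_cons linearD (idp y Ny) linear_sum opprD addrACA.
  rewrite subrr add0r -sumrB big_filter [RHS]big_mkcond /=.
  apply: eq_big_seq => z zs; case: asboolP => Nz /=; first by rewrite idp ?subrr.
  have [K FK Kz] := Fs' z zs.
  by rewrite (p0 K) ?subr0 // => KN; apply: Nz; rewrite -KN.
- by apply: leq_trans lesn; rewrite ltnS size_filter count_size.
Qed.

Lemma semisimple_semiprime : semisimple M -> semiprime M.
Proof.
move=> [F [Fsimple indF FT]] K sK Kinv KK0.
have sF N : F N -> submodule N by move=> /Fsimple[].
apply/seteqP; split=> [x Kx|_ ->]; last exact: submod0.
apply: (summand_proj_eq0 sF indF FT) => N p FN [pN idp _].
apply: contrapT => px0.
have Kpx : K (p x) by apply: (Kinv p); exists x.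
have NK : N `<=` K by exact: (simple_sub (Fsimple _ FN) sK (pN x) Kpx px0).
apply: px0; suff : submod_prod K K (p x) by rewrite KK0.
apply: (@sum_submod_sup _ (p @` K)); last by exists x.
by exists p => // z; exact/NK/pN.
Qed.

End SubmoduleTheory.

Theorem theorem1p17 (R : pzRingType) (M : lmodType R) (hM : retractable M) :
  [<-> semisimple M /\ artinian M;
       semiprime M /\ artinian M;
       [/\ semiprime M, dcc_cyclic_submodules M & dcc_direct_summands M]].
Proof.
tfae.
- by move=> [/semisimple_semiprime].
- move=> [Mprime Mart]; split=> // N PN; apply: Mart => n.
    by have [x ->] := PN n; exact: submodule_cyclic.
  by have [] := PN n.
- move=> [Mprime Mcyc Msum]; split; first exact: semiprime_dcc_semisimple.
  (* Every submodule is now a direct summand, so the chain condition on summands covers all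
     submodules. *)
  by move=> N sN Ndec; apply: (Msum) => // n; exact: submodule_direct_summand.
Qed.
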